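(* Consider the multilateral collaboration market with transferable utilities described in the context. Suppose that every agent's valuation takes integer values (i.e. $v_i(\Psi)\in\mathbb{Z}$ for every $i\in I$ and $\Psi\subseteq\Omega_i$), that primitive contracts are gross complements for every agent, and that agents report truthfully (i.e. at each step with current price vector $\mathbf{p}$, each agent $i$ reports exactly the collection $D_i(\mathbf{p}_i)$). Then, from any initial integer balanced price vector $\mathbf{p}(1)\in\mathbb{B}\cap\mathbb{Z}^K$, the dynamic auction for multilateral collaboration (described in the context) terminates after finitely many steps, and the outcome it produces is a stable outcome.
   Context: **Market.** $I$ is a finite set of agents and $\Omega$ a finite set of primitive contracts. Each $w\in\Omega$ has a set of participants $N(w)\subseteq I$ with $|N(w)|\ge 2$. For $\Psi\subseteq\Omega$ and $i\in I$ let $\Psi_i=\{w\in\Psi: i\in N(w)\}$; in particular $\Omega_i=\{w\in\Omega: i\in N(w)\}$. A contract is a pair $x=(w,\mathbf{t}^w)$ with $w\in\Omega$ and $\mathbf{t}^w\in T^w=\{\mathbf{t}\in\mathbb{R}^{N(w)}:\sum_{i\in N(w)}t_i=0\}$ ($t_i^w$ is the payment made by agent $i$); $X$ is the set of all contracts, $\tau(x)=w$, $N(x)=N(w)$. For $Y\subseteq X$: $\tau(Y)=\{\tau(y):y\in Y\}$, $Y_i=\{y\in Y:i\in N(y)\}$, $N(Y)=\bigcup_{y\in Y}N(y)$. Each agent $i$ has a valuation $v_i:2^{\Omega_i}\to\mathbb{R}$. **Stability.** Agent $i$'s utility from $Y\subseteq X$ is $u_i(Y)=v_i(\tau(Y)\cap\Omega_i)-\sum_{(w,\mathbf{t}^w)\in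 Y_i}t_i^w$ if distinct contracts in $Y_i$ have distinct primitive contracts, where $\tau(Y)\cap\Omega_i=\tau(Y_i)$, and $u_i(Y)=-\infty$ otherwise. For $Y\subseteq X_i$, $C_i(Y)=\arg\max\{u_i(S):S\subseteq Y\}$. An outcome is a set $Y\subseteq X$ in which distinct contracts have distinct primitive contracts. An outcome $Y$ is individually rational if $Y_i\in C_i(Y_i)$ for all $i\in I$. A nonempty set $Z\subseteq X\setminus Y$ blocks $Y$ if for every $i\in N(Z)$ there is $Y'\in C_i(Y_i\cup Z_i)$ with $Z_i\subseteq Y'$. An outcome is stable if it is individually rational and not blocked by any nonempty $Z\subseteq X\setminus Y$. **Prices and demand.** Let $K=\{(i,w):i\in I,\ w\in\Omega_i\}$. For $\mathbf{p}\in\mathbb{R}^K$ write $\mathbf{p}_i=(p_i^w)_{w\in\Omega_i}$. The set of balanced price vectors is $\mathbb{B}=\{\mathbf{p}\in\mathbb{R}^K:\sum_{i\in N(w)}p_i^w=0\ \forall w\in\Omega\}$. Agent $i$'s demand correspondence is $D_i(\mathbf{p}_i)=\arg\max_{\Psi\subseteq\Omega_i}\{v_i(\Psi)-\sum_{w\in\Psi}p_i^w\}$. A pair $(\Phi,\mathbf{p})$ with $\Phi\subseteq\Omega$, $\mathbf{p}\in\mathbb{B}$ is a competitive equilibrium if $\Phi_i\in D_i(\mathbf{p}_i)$ for all $i\in I$; $\mathbf{p}\in\mathbb{B}$ is an equilibrium price vector if some such $\Phi$ exists, and a non-equilibrium price vector otherwise. **Gross complements.** Primitive contracts are gross complements for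 agent $i$ if for all $\mathbf{p}_i\ge\mathbf{q}_i$ in $\mathbb{R}^{\Omega_i}$ (coordinatewise) and all $\Phi\in D_i(\mathbf{p}_i)$ there is $\Psi\in D_i(\mathbf{q}_i)$ with $\{w\in\Phi:p_i^w=q_i^w\}\subseteq\Psi$. **Verification procedure at $\mathbf{p}\in\mathbb{B}$.** Let $\underline{d}_i(\mathbf{p}_i)=\bigcap_{\Psi\in D_i(\mathbf{p}_i)}\Psi$ and $H(\mathbf{p})=\{w: w\in\underline{d}_i(\mathbf{p}_i)\text{ for some }i\in I\}$. Let $\Omega^1(\mathbf{p})=\Omega$. For $k\ge1$, given $\Omega^k(\mathbf{p})$, let $\overline{d}^k_i(\mathbf{p}_i)=\bigcup\{\Psi\in D_i(\mathbf{p}_i):\Psi\subseteq\Omega^k(\mathbf{p})\}$ for each $i\in I$ and $G^k(\mathbf{p})=\{w:\ w\in\overline{d}^k_j(\mathbf{p}_j)\text{ and }w\notin\overline{d}^k_{j'}(\mathbf{p}_{j'})\text{ for some }j,j'\in N(w)\}$. At Step $k\geq 1$: (i) if $G^k(\mathbf{p})=\emptyset$, the procedure terminates, declares $\mathbf{p}$ an equilibrium price vector, and outputs the outcome $\{(w,\mathbf{t}^w): w\in\bigcup_{i\in I}\overline{d}^k_i(\mathbf{p}_i),\ t_i^w=p_i^w\ \forall i\in N(w)\}$; (ii) if $G^k(\mathbf{p})\cap H(\mathbf{p})\ne\emptyset$, it terminates and declares $\mathbf{p}$ a non-equilibrium price vector; (iii) otherwise set $\Omega^{k+1}(\mathbf{p})=\Omega^k(\mathbf{p})\setminus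 G^k(\mathbf{p})$ and go to Step $k+1$. **Complements chain.** A primitive contract $w'\in\Omega_i$ is a complement to another primitive contract $w\in\Omega_i$ for agent $i$ at $\mathbf{p}_i$ if $w\in\Psi$ for some $\Psi\in D_i(\mathbf{p}_i)$, and every $\Psi\in D_i(\mathbf{p}_i)$ with $w\in\Psi$ satisfies $w'\in\Psi$. If the verification procedure at $\mathbf{p}$ stops at Step $s\ge1$ because $G^s(\mathbf{p})\cap H(\mathbf{p})\neq\emptyset$, a complements chain at $\mathbf{p}$ is a sequence $i^1w^1i^2w^2\cdots w^si^{s+1}$ of agents $i^l$ and primitive contracts $w^l$ with $w^l\in\Omega_{i^l}\cap\Omega_{i^{l+1}}$ for $1\le l\le s$ such that: (i) $w^l\in G^l(\mathbf{p})$, $w^l\notin\overline{d}^l_{i^l}(\mathbf{p}_{i^l})$ and $w^l\in\overline{d}^l_{i^{l+1}}(\mathbf{p}_{i^{l+1}})$ for all $1\le l\le s$; (ii) $w^s\in H(\mathbf{p})$ and $w^s\in\underline{d}_{i^{s+1}}(\mathbf{p}_{i^{s+1}})$; (iii) if $s\ge2$, $w^{l-1}$ is a complement to $w^l$ for agent $i^l$ at $\mathbf{p}_{i^l}$ for all $2\le l\le s$. **Dynamic auction.** Step 0: the auctioneer announces $\mathbf{p}(1)\in\mathbb{B}\cap\mathbb{Z}^K$. Step $r\ge1$: each agent $i$ reports all her demand sets $D_i(\mathbf{p}(r)_i)$, and the auctioneer runs the verification procedure at $\mathbf{p}(r)$. If $\mathbf{p}(r)$ is declared an equilibrium price vector,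 the auction terminates with the outcome output by the procedure. If it is declared a non-equilibrium price vector, the auctioneer finds one or more complements chains at $\mathbf{p}(r)$ whose sets of agents are pairwise disjoint, obtains $\mathbf{p}(r+1)$ from $\mathbf{p}(r)$ by applying, for each selected chain $i^1w^1\cdots w^si^{s+1}$ and each $1\le l\le s$, the changes: decrease the coordinate $(i^l,w^l)$ by $1$ and increase the coordinate $(i^{l+1},w^l)$ by $1$ (all other coordinates unchanged), and goes to Step $r+1$. (The selection of chains is otherwise arbitrary; the claim includes that at least one chain is available whenever a non-equilibrium price vector is declared.) *)

(* Defs.v *)
From HB Require Import structures.
From mathcomp Require Import all_boot all_order all_algebra.
From mathcomp Require Import all_classical all_reals.

Set Implicit Arguments.
Unset Strict Implicit.
Unset Printing Implicit Defensive.

Import Order.TTheory GRing.Theory Num.Theory.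
Local Open Scope ring_scope.
Local Open Scope classical_set_scope.

(* Sets of agents and of primitive contracts, which range over finite types,
   are finite sets {set _}.  There are infinitely many contracts, so sets of
   contracts are classical sets. *)

Section Market.
Variables (R : realType) (I Omega : finType).
Variable N : Omega -> {set I}.
(* Only the values v i Psi with Psi \subset contracts_of i are meaningful. *)
Variable v : I -> {set Omega} -> R.

Definition contracts_of (i : I) : {set Omega} := [set w | i \in N w]%SET.

Definition contract :=
  {x : {w : Omega & {ffun {i : I | i \in N w} -> R}}
     | \sum_j tagged x j == 0}.

Definition tau (x : contract) : Omega := tag (val x).

(* The payment of agent i in x, set to 0 when i does not participate in x. *)
Definition payment (x : contract) (i : I) : R :=
  if insub i is Some j then tagged (val x) j else 0.

Definition involving (Y : set contract) (i : I) : set contract :=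
  [set x | Y x /\ i \in N (tau x)].

Definition prims (Y : set contract) : {set Omega} :=
  [set w | `[< exists2 x, Y x & tau x = w >]]%SET.

Definition participants (Y : set contract) : set I :=
  [set i | exists2 x, Y x & i \in N (tau x)].

Definition distinct_prims (Y : set contract) : Prop :=
  forall x y, Y x -> Y y -> tau x = tau y -> x = y.

(* The sum is over a set with at most #|Omega| elements: the first branch is
   taken only if tau is injective on involving Y i. *)
Definition utility (i : I) (Y : set contract) : \bar R :=
  if `[< distinct_prims (involving Y i) >] then
    (v i (prims Y :&: contracts_of i)%SET
       - \sum_(x \in involving Y i) payment x i)%:E
  else -oo%E.

Definition choice_corr (i : I) (Y : set contract) : set (set contract) :=
  [set S | S `<=` Y /\
    forall S', S' `<=` Y -> (utility i S' <= utility i S)%E].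

Definition outcome (Y : set contract) : Prop := distinct_prims Y.

Definition individually_rational (Y : set contract) : Prop :=
  forall i, choice_corr i (involving Y i) (involving Y i).

Definition blocks (Z Y : set contract) : Prop :=
  [/\ Z !=set0, Z `<=` ~` Y &
    forall i, participants Z i ->
      exists2 Y', choice_corr i (involving Y i `|` involving Z i) Y' &
        involving Z i `<=` Y'].

Definition stable (Y : set contract) : Prop :=
  [/\ outcome Y, individually_rational Y & forall Z, ~ blocks Z Y].

(* A price vector indexed by the pairs (i, w) with i \in N w is represented by
   a function on all pairs, whose values at the other pairs are never used;
   likewise p i : Omega -> R represents the prices of the contracts of i. *)
Definition price := I -> Omega -> R.

Definition balanced (p : price) : Prop :=
  forall w, \sum_(i in N w) p i w = 0.

Definition integral_price (p : price) : Prop :=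
  forall i w, i \in N w -> p i w \is a Num.int.

Definition integer_valued (i : I) : Prop :=
  forall Psi : {set Omega}, Psi \subset contracts_of i ->
    v i Psi \is a Num.int.

Definition net_value (i : I) (pi : Omega -> R) (Psi : {set Omega}) : R :=
  v i Psi - \sum_(w in Psi) pi w.

Definition demand (i : I) (pi : Omega -> R) : {set {set Omega}} :=
  [set Psi : {set Omega} | (Psi \subset contracts_of i) &&
     [forall S : {set Omega}, (S \subset contracts_of i) ==>
        (net_value i pi S <= net_value i pi Psi)]]%SET.

Definition gross_complements (i : I) : Prop :=
  forall p q : Omega -> R,
    (forall w, w \in contracts_of i -> q w <= p w) ->
    forall Phi, Phi \in demand i p ->
      exists2 Psi, Psi \in demand i q &
        [set w in Phi | p w == q w]%SET \subset Psi.

(* The auctioneer knows prices only through the reported demand sets: the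
   verification procedure and complements chains are functions of a profile
   of reports, which is fun i => demand i (p i) under truthful reporting. *)
Definition reports := I -> {set {set Omega}}.

Section Verification.
Variable D : reports.

Definition dlow (i : I) : {set Omega} := (\bigcap_(Psi in D i) Psi)%SET.

Definition Hset : {set Omega} := [set w | [exists i, w \in dlow i]]%SET.

Definition dup_in (A : {set Omega}) (i : I) : {set Omega} :=
  (\bigcup_(Psi in D i | Psi \subset A) Psi)%SET.

Definition Gset_in (A : {set Omega}) : {set Omega} :=
  [set w | [exists j in N w, w \in dup_in A j] &&
           [exists j in N w, w \notin dup_in A j]]%SET.

(* Steps are numbered from 1; index 0 is not used. *)
Definition Omega_at (k : nat) : {set Omega} :=
  iter k.-1 (fun A : {set Omega} => A :\: Gset_in A)%SET [set: Omega]%SET.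

Definition dup (k : nat) (i : I) : {set Omega} := dup_in (Omega_at k) i.

Definition Gset (k : nat) : {set Omega} := Gset_in (Omega_at k).

Definition verif_reaches (s : nat) : Prop :=
  (1 <= s)%N /\
  forall k, (1 <= k < s)%N ->
    Gset k != finset.set0 /\ (Gset k :&: Hset)%SET = finset.set0.

Definition declares_eq (s : nat) : Prop :=
  verif_reaches s /\ Gset s = finset.set0.

Definition declares_noneq (s : nat) : Prop :=
  verif_reaches s /\ (Gset s :&: Hset)%SET != finset.set0.

Definition verif_output (p : price) (s : nat) : set contract :=
  [set x | (exists i, tau x \in dup s i) /\
           forall i, i \in N (tau x) -> payment x i = p i (tau x)].

Definition complement_to (i : I) (w' w : Omega) : Prop :=
  [/\ w' \in contracts_of i, w \in contracts_of i & w' != w] /\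
  (exists2 Psi, Psi \in D i & w \in Psi) /\
  (forall Psi, Psi \in D i -> w \in Psi -> w' \in Psi).

(* In a chain of length s only the agents ag 1, ..., ag s.+1 and the primitive
   contracts pc 1, ..., pc s are used. *)
Record chain := Chain { ag : nat -> I; pc : nat -> Omega }.

Definition complements_chain (s : nat) (c : chain) : Prop :=
  [/\ forall l, (1 <= l <= s)%N ->
        pc c l \in (contracts_of (ag c l) :&: contracts_of (ag c l.+1))%SET,
      forall l, (1 <= l <= s)%N ->
        [/\ pc c l \in Gset l,
            pc c l \notin dup l (ag c l) &
            pc c l \in dup l (ag c l.+1)],
      pc c s \in Hset /\ pc c s \in dlow (ag c s.+1) &
      forall l, (2 <= l <= s)%N ->
        complement_to (ag c l) (pc c l.-1) (pc c l)].

Definition disjoint_chains (s : nat) (c c' : chain) : Prop :=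
  forall l l', (1 <= l <= s.+1)%N -> (1 <= l' <= s.+1)%N -> ag c l != ag c' l'.

Definition price_change (s : nat) (c : chain) (i : I) (w : Omega) : R :=
  \sum_(1 <= l < s.+1)
    (((ag c l.+1, pc c l) == (i, w))%:R - ((ag c l, pc c l) == (i, w))%:R).

Definition price_update (p p' : price) : Prop :=
  exists s, declares_noneq s /\
  exists m (c : 'I_m -> chain),
    [/\ (0 < m)%N,
        forall a, complements_chain s (c a),
        forall a b, a != b -> disjoint_chains s (c a) (c b) &
        forall i w, i \in N w ->
          p' i w = p i w + \sum_(a < m) price_change s (c a) i w].

End Verification.

(* P 1, ..., P n are the first n prices announced in some execution of the
   auction from p1, when the agents report rep p at price vector p. *)
Definition auction_path (rep : price -> reports) (p1 : price)
    (P : nat -> price) (n : nat) : Prop :=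
  [/\ (1 <= n)%N, P 1%N = p1 &
    forall r, (1 <= r < n)%N -> price_update (rep (P r)) (P r) (P r.+1)].

Definition truthful (rep : price -> reports) : Prop :=
  forall p i, rep p i = demand i (p i).

End Market.

(* Main.v *)
Require Import Defs.
From HB Require Import structures.
From mathcomp Require Import all_boot all_order all_algebra.
From mathcomp Require Import all_classical all_reals.
From mathcomp Require Import zify ring lra.

Set Implicit Arguments.
Unset Strict Implicit.
Unset Printing Implicit Defensive.

Import Order.TTheory GRing.Theory Num.Theory.
Local Open Scope ring_scope.
Local Open Scope classical_set_scope.

(* Gross complements makes every valuation supermodular, so that demand sets are
   closed under union and intersection.  If the verification procedure fails, the
   least demand sets containing the removed contracts therefore link up into a
   complements chain.
   Termination: the sum of the indirect utilities is bounded below and integral at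
   integral prices, and each chain lowers it by at least 1: the last agent pays one
   unit more for a contract in all her demand sets, and no other agent gains.
   Stability: the terms of a blocking set Z are balanced, so its members are all
   indifferent to it; adding Z to the output then gives a larger equilibrium
   allocation, whereas the procedure never removes a contract that belongs to one. *)

(** * Demand sets under gross complements: supermodularity and lattice structure *)

Section Demand.
Variables (R : realType) (I Omega : finType).
Variables (N : Omega -> {set I}) (v : I -> {set Omega} -> R) (i : I).
Implicit Types (S T Psi : {set Omega}) (pi : Omega -> R).

Let own := contracts_of N i.

Definition indirect_utility pi : R :=
  net_value v i pi
    [arg max_(Psi > finset.set0 | Psi \subset own) net_value v i pi Psi]%O.

Lemma indirect_utility_ub pi Psi : Psi \subset own ->
  net_value v i pi Psi <= indirect_utility pi.
Proof.
rewrite /indirect_utility; case: arg_maxP => [|S _ Smax /Smax //].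
exact: finset.sub0set.
Qed.

Lemma demandP pi Psi :
  reflect (Psi \subset own /\ net_value v i pi Psi = indirect_utility pi)
          (Psi \in demand N v i pi).
Proof.
rewrite finset.in_set; apply: (iffP andP) => -[sub opt]; split=> //.
  apply/le_anti; rewrite indirect_utility_ub //=.
  rewrite /indirect_utility; case: arg_maxP => [|S Ssub _].
    exact: finset.sub0set.
  by apply: (implyP (forallP opt S)).
by apply/forallP=> S; apply/implyP=> Ssub; rewrite opt indirect_utility_ub.
Qed.

Lemma demand_exists pi : exists Psi, Psi \in demand N v i pi.
Proof.
exists [arg max_(Psi > finset.set0 | Psi \subset own) net_value v i pi Psi]%O.
apply/demandP; split=> //; case: arg_maxP => //; exact: finset.sub0set.
Qed.

Section ForcingPrices.

Variables (S : {set Omega}) (a : Omega) (c : R).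

(** Strictly more than [|c|] plus the difference of any two valuations, so that one misplaced
    contract at price [M] or [- M] outweighs everything else. *)
Definition forcing_bound : R := 1 + `|c| + 2 * \sum_(Psi : {set Omega}) `|v i Psi|.

Definition forcing_price (M : R) (w : Omega) : R :=
  if w \in S then - M else if w == a then c else M.

Lemma net_value_forcing M Psi : a \notin S ->
  net_value v i (forcing_price M) Psi =
    v i Psi - c *+ (a \in Psi) +
    M * (#|Psi :&: S|%:R - #|Psi :\: (a |: S)|%:R)%SET.
Proof.
move=> aS; rewrite /net_value -addrA; congr (_ + _).
have -> : \sum_(w in Psi) forcing_price M w =
    \sum_(w in Psi) (c *+ (w == a) - M *+ (w \in S) + M *+ (w \notin a |: S)%SET).
  apply: eq_bigr => w _; rewrite /forcing_price finset.in_setU1.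
  case: (boolP (w \in S)) => [wS|_]; last by case: eqP => _ /=; lra.
  have -> : (w == a) = false by apply/negP=> /eqP wa; rewrite -wa wS in aS.
  by rewrite /=; lra.
rewrite !big_split /= sumrN.
have cnt (P : {set Omega}) (x : R) :
    \sum_(w in Psi) x *+ (w \in P) = x * #|(Psi :&: P)%SET|%:R.
  rewrite mulr_natr -sumr_const big_mkcond [RHS]big_mkcond /=.
  by apply: eq_bigr => w _; rewrite finset.in_setI; case: (w \in Psi); case: (w \in P).
have -> : \sum_(w in Psi) c *+ (w == a) = c *+ (a \in Psi).
  have := cnt [set a]%SET c; under eq_bigr do rewrite finset.in_set1.
  move=> ->; rewrite mulr_natr; congr (_ *+ _).
  case: (boolP (a \in Psi)) => aP.
    by rewrite (finset.setIidPr _) ?finset.sub1set ?cards1.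
  apply/eqP; rewrite cards_eq0 finset.setI_eq0 disjoint_sym disjoints1.
  exact: aP.
rewrite cnt.
have -> : \sum_(w in Psi) M *+ (w \notin (a |: S)%SET) =
    M * #|(Psi :\: (a |: S))%SET|%:R.
  by rewrite finset.setDE -cnt; apply: eq_bigr => w _; rewrite finset.in_setC.
by ring.
Qed.

(** In [net_value_forcing] the coefficient of [M] is [#|S|] only for [S] and [a |: S]; any other set
    loses at least one full [M]. *)
Lemma forcing_price_lt M Psi : forcing_bound <= M -> a \notin S ->
  Psi != S -> Psi != (a |: S)%SET ->
  net_value v i (forcing_price M) Psi < net_value v i (forcing_price M) S.
Proof.
move=> leM aS PS PaS; rewrite !net_value_forcing // (negbTE aS) mulr0n.
rewrite finset.setIid.
have -> : (S :\: (a |: S))%SET = finset.set0.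
  by apply/eqP; rewrite finset.setD_eq0 finset.subsetUr.
rewrite cards0 !subr0.
have vle T : `|v i T| <= \sum_(Phi : {set Omega}) `|v i Phi|.
  by rewrite (bigD1 T) //= lerDl sumr_ge0.
have vP := vle Psi; have vS := vle S.
have M0 : 0 <= M.
  apply: le_trans leM; rewrite /forcing_bound !addr_ge0 ?mulr_ge0 //.
  exact: sumr_ge0.
have cnt : (#|Psi :&: S|.+1 <= #|S| + #|Psi :\: (a |: S)|)%SET%N.
  rewrite ltnNge; apply/negP => le.
  have le1 : (#|Psi :&: S| <= #|S|)%SET%N by rewrite subset_leq_card ?finset.subsetIr.
  have eqS : (Psi :&: S)%SET = S.
    by apply/eqP; rewrite eqEcard finset.subsetIr /=; lia.
  have D0 : (Psi :\: (a |: S))%SET = finset.set0 by apply/eqP; rewrite -cards_eq0; lia.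
  have sSP : S \subset Psi by rewrite -eqS finset.subsetIl.
  have sPa : Psi \subset (a |: S)%SET by rewrite -finset.setD_eq0 D0.
  case: (boolP (a \in Psi)) => aP.
    case/eqP: PaS; apply/eqP; rewrite finset.eqEsubset sPa finset.subUset sSP.
    by rewrite finset.sub1set aP.
  case/eqP: PS; apply/eqP; rewrite finset.eqEsubset sSP andbT; apply/fintype.subsetP=> w wP.
  have := fintype.subsetP sPa w wP; rewrite finset.in_setU1 => /orP[/eqP wa|//].
  by rewrite wa (negbTE aP) in wP.
have : M * (#|Psi :&: S|%:R - #|Psi :\: (a |: S)|%:R)%SET + M <= M * #|S|%:R.
  rewrite -{2}[M]mulr1 -mulrDr ler_wpM2l //.
  have : ((#|Psi :&: S|.+1)%:R <= (#|S| + #|Psi :\: (a |: S)|)%:R :> R)%SET.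
    by rewrite ler_nat.
  by rewrite natrD -natr1; lra.
have cn : - `|c| <= c *+ (a \in Psi).
  by case: (_ \in _); rewrite ?mulr1n ?mulr0n ?oppr_le0 // lerNl -normrN ler_norm.
move: leM; rewrite /forcing_bound.
have := ler_norm (v i Psi); have := ler_norm (- v i S); rewrite normrN.
lra.
Qed.

End ForcingPrices.

Hypothesis gc : gross_complements N v i.

(* Price a at its marginal value at S and force everything else, so that S and
   a |: S are demanded; raising the forced set from S to T lowers the other
   prices, hence a is still demanded there. *)
Lemma marginal_increasing S T a : S \subset T -> T \subset own -> a \in own ->
  a \notin T -> v i (a |: S)%SET - v i S <= v i (a |: T)%SET - v i T.
Proof.
move=> sST sT aO aT; set c := v i (a |: S)%SET - v i S.
have aS : a \notin S by apply: contra aT; apply: (fintype.subsetP sST).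
set M := forcing_bound c.
have M0 : 0 <= M by rewrite /M /forcing_bound !addr_ge0 ?mulr_ge0 // sumr_ge0.
pose p := forcing_price S a c M; pose q := forcing_price T a c M.
have pq w : w \in contracts_of N i -> q w <= p w.
  move=> _; rewrite /p /q /forcing_price.
  case: (boolP (w \in S)) => [/(fintype.subsetP sST) -> //|_].
  case: ifP => [wT|_]; last by case: eqP.
  have -> : (w == a) = false by apply/eqP=> wa; rewrite -wa wT in aT.
  by lra.
have eqa (X : {set Omega}) : a \notin X -> net_value v i (forcing_price X a c M) (a |: X)%SET =
    net_value v i (forcing_price X a c M) X - c + (v i (a |: X)%SET - v i X).
  move=> aX; rewrite {1 2}/net_value big_setU1 //= {1}/forcing_price (negbTE aX) eqxx.
  lra.
have only (X Psi : {set Omega}) : X \subset own -> a \notin X ->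
    Psi \in demand N v i (forcing_price X a c M) ->
    Psi = X \/ Psi = (a |: X)%SET.
  move=> sX aX /demandP[sP eqP]; case: (eqVneq Psi X) => [|PX]; first by left.
  case: (eqVneq Psi (a |: X)%SET) => [|PaX]; first by right.
  have := forcing_price_lt (lexx M) aX PX PaX.
  by rewrite eqP ltNge indirect_utility_ub.
have sS : S \subset own := fintype.subset_trans sST sT.
have sub (X : {set Omega}) : X \subset own -> (a |: X)%SET \subset own.
  by move=> sX; rewrite finset.subUset finset.sub1set aO.
have dS : (a |: S)%SET \in demand N v i p.
  have eqS : net_value v i p (a |: S)%SET = net_value v i p S by rewrite /p eqa // -/c subrK.
  case: (demand_exists p) => Psi dPsi; apply/demandP; split; first exact: sub.
  case: (only _ _ sS aS dPsi) => eqPsi; rewrite eqPsi in dPsi;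
    by case/demandP: dPsi => _ <-.
have [Psi dPsi aPsi] := gc pq dS.
(* Both price vectors charge [c] for [a], so gross complements carries [a] over to [Psi]. *)
have aP : a \in Psi.
  apply: (fintype.subsetP aPsi); rewrite finset.in_set finset.setU11 /=.
  by rewrite /p /q /forcing_price (negbTE aS) (negbTE aT) eqxx.
case: (only _ _ sT aT dPsi) => eqPsi; rewrite eqPsi ?(negbTE aT) // in aP dPsi.
have /demandP[_ dT] := dPsi.
have := indirect_utility_ub q sT; rewrite -dT /q eqa //; lra.
Qed.

(** Induction on the size of [A :\: B]: an element [a] of it is removed from [A], and its marginal
    value at [A :\ a] is compared with that at [(A :\ a) :|: B]. *)
Lemma supermodular (A B : {set Omega}) : A \subset own -> B \subset own ->
  v i A + v i B <= v i (A :|: B)%SET + v i (A :&: B)%SET.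
Proof.
move: {2}#|_| (leqnn #|(A :\: B)%SET|) => n.
elim: n A => [|n IH] A leAB sA sB.
  have sAB : A \subset B by rewrite -finset.setD_eq0 -cards_eq0; lia.
  by rewrite (finset.setUidPr sAB) (finset.setIidPl sAB) addrC.
case: (finset.set_0Vmem (A :\: B)%SET) => [D0|[a]].
  by apply: IH => //; rewrite D0 cards0.
rewrite finset.in_setD => /andP[aB aA].
have sA' : (A :\ a)%SET \subset own by rewrite (fintype.subset_trans (finset.subD1set _ _)).
have leA' : (#|(A :\ a) :\: B| <= n)%SET%N.
  have -> : ((A :\ a) :\: B)%SET = ((A :\: B) :\ a)%SET.
    by apply/finset.setP=> w; rewrite !finset.in_setD !finset.in_set1 andbCA.
  by move: leAB; rewrite (cardsD1 a) finset.in_setD aA aB.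
have := IH (A :\ a)%SET leA' sA' sB.
have -> : ((A :\ a) :&: B)%SET = (A :&: B)%SET.
  apply/finset.setP=> w; rewrite !finset.in_setI finset.in_setD1.
  by case: eqP => // ->; rewrite (negbTE aB) !andbF.
have aT : a \notin ((A :\ a) :|: B)%SET.
  by rewrite finset.in_setU finset.in_setD1 eqxx (negbTE aB).
have := @marginal_increasing (A :\ a)%SET ((A :\ a) :|: B)%SET a (finset.subsetUl _ _).
rewrite finset.setUA finset.setD1K // finset.subUset sA' sB aT (fintype.subsetP sA) //.
by move=> /(_ isT isT isT); lra.
Qed.

Lemma net_value_supermodular pi (A B : {set Omega}) : A \subset own -> B \subset own ->
  net_value v i pi A + net_value v i pi B <=
  net_value v i pi (A :|: B)%SET + net_value v i pi (A :&: B)%SET.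
Proof.
move=> sA sB; rewrite /net_value; have := supermodular sA sB.
have : \sum_(w in (A :|: B)%SET) pi w + \sum_(w in (A :&: B)%SET) pi w =
       \sum_(w in A) pi w + \sum_(w in B) pi w.
  rewrite !(big_mkcond (fun w => w \in _)) -!big_split /=; apply: eq_bigr => w _.
  rewrite finset.in_setU finset.in_setI.
  by case: (w \in A); case: (w \in B); rewrite ?addr0 ?add0r.
lra.
Qed.

(** The net values of union and intersection add up to at least twice the maximum, so neither can
    fall short of it. *)
Lemma demand_lattice pi A B : A \in demand N v i pi -> B \in demand N v i pi ->
  (A :|: B)%SET \in demand N v i pi /\ (A :&: B)%SET \in demand N v i pi.
Proof.
move=> /demandP[sA eA] /demandP[sB eB].
have sU : (A :|: B)%SET \subset own by rewrite finset.subUset sA.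
have sI : (A :&: B)%SET \subset own by rewrite (fintype.subset_trans (finset.subsetIl _ _)).
have := net_value_supermodular pi sA sB.
have := indirect_utility_ub pi sU; have := indirect_utility_ub pi sI.
by rewrite eA eB => *; split; apply/demandP; split=> //; lra.
Qed.

End Demand.

(** * The verification procedure and complements chains *)

Section Verification.
Variables (I Omega : finType) (N : Omega -> {set I}) (D : reports I Omega).
Implicit Types (A Psi : {set Omega}) (w : Omega) (i j : I) (k l s : nat).

Lemma Omega_atS k : (1 <= k)%N -> Omega_at N D k.+1 = (Omega_at N D k :\: Gset N D k)%SET.
Proof. by case: k. Qed.

Lemma Omega_at_anti k l : (k <= l)%N -> Omega_at N D l \subset Omega_at N D k.
Proof.
move=> /subnK <-; elim: (l - k)%N => // n; apply: fintype.subset_trans.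
rewrite addSn; case: (n + k)%N => // m; rewrite Omega_atS //; exact: finset.subsetDl.
Qed.

Lemma mem_dup_in A i w :
  reflect (exists2 Psi, Psi \in D i & (Psi \subset A) && (w \in Psi)) (w \in dup_in D A i).
Proof.
apply: (iffP finset.bigcupP) => [[Psi /andP[dP sP] wP]|[Psi dP /andP[sP wP]]].
  by exists Psi; rewrite ?sP.
by exists Psi; rewrite ?dP.
Qed.

Lemma dup_in_sub A i : dup_in D A i \subset A.
Proof. by apply/finset.bigcupsP=> Psi /andP[]. Qed.

Lemma dup_anti k l i : (k <= l)%N -> dup N D l i \subset dup N D k i.
Proof.
move=> /Omega_at_anti sO; apply/fintype.subsetP=> w /mem_dup_in[Psi dP /andP[sP wP]].
by apply/mem_dup_in; exists Psi; rewrite ?wP ?(fintype.subset_trans sP).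
Qed.

Lemma GsetP k w :
  reflect ((exists2 j, j \in N w & w \in dup N D k j) /\
           (exists2 j, j \in N w & w \notin dup N D k j)) (w \in Gset N D k).
Proof.
rewrite finset.in_set.
by apply: (iffP andP) => -[] /exists_inP ? /exists_inP ?; split => //; apply/exists_inP.
Qed.

Lemma Gset_sub k : Gset N D k \subset Omega_at N D k.
Proof.
by apply/fintype.subsetP=> w /GsetP[[j _ /(fintype.subsetP (dup_in_sub _ _))]].
Qed.

Lemma dup_notin_Gset k w i j : w \notin Gset N D k -> i \in N w -> j \in N w ->
  w \in dup N D k i -> w \in dup N D k j.
Proof.
move=> wG iw jw wi; apply: contraR wG => wj.
by apply/GsetP; split; [exists i|exists j].
Qed.

(** A step that does not stop removes a nonempty set, so at most [#|Omega|] such steps are possible;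
    the least stopping index is the one reached. *)
Lemma verification_stops :
  exists2 s, verif_reaches N D s &
    Gset N D s = finset.set0 \/ (Gset N D s :&: Hset D)%SET != finset.set0.
Proof.
pose stop k := (1 <= k)%N && ((Gset N D k == finset.set0) ||
                  ((Gset N D k :&: Hset D)%SET != finset.set0)).
have ex : exists k, stop k.
  apply/not_existsP => nstop.
  have card k : (#|Omega_at N D k.+1| + k <= #|Omega|)%N.
    elim: k => [|k IH]; first by rewrite addn0 max_card.
    have G0 : (0 < #|Gset N D k.+1|)%N.
      by rewrite card_gt0; apply/negP => G0; case: (nstop k.+1); rewrite /stop G0.
    rewrite Omega_atS // cardsD (finset.setIidPr (Gset_sub _)).
    have := subset_leq_card (Gset_sub k.+1); lia.
  by have := card #|Omega|.+1; lia.
case: (ex_minnP ex) => s /andP[s1 sP] smin; exists s; last first.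
  by case/orP: sP => [/eqP|]; [left|right].
split=> // k /andP[k1 ks]; have : ~~ stop k.
  by apply/negP => /smin; rewrite leqNgt ks.
by rewrite /stop k1 /= negb_or negbK => /andP[-> /eqP].
Qed.

(** These three properties are what truthful reports provide under gross complements; the rest of
    the section argues on reports alone. *)
Hypothesis D_own : forall i Psi, Psi \in D i -> Psi \subset contracts_of N i.
Hypothesis D_ex : forall i, exists Psi, Psi \in D i.
Hypothesis D_lattice : forall i Phi Psi, Phi \in D i -> Psi \in D i ->
  (Phi :|: Psi)%SET \in D i /\ (Phi :&: Psi)%SET \in D i.

Lemma dup_in_demand A i Psi : Psi \in D i -> Psi \subset A -> dup_in D A i \in D i.
Proof.
(* Absorbing [Psi] into the union lets the induction start from [Psi] instead of the empty set,
   which may not be demanded. *)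
move=> dP sP; have /finset.setUidPr <- : Psi \subset dup_in D A i.
  by apply: finset.bigcup_sup; rewrite dP.
apply: (big_rec (fun X => (Psi :|: X)%SET \in D i)); first by rewrite finset.setU0.
by move=> Phi X /andP[dPhi _] dX; rewrite finset.setUCA; case: (D_lattice dPhi dX).
Qed.

Lemma bigcap_demand i (P : pred {set Omega}) Psi : Psi \in D i -> P Psi ->
  (\bigcap_(Phi in D i | P Phi) Phi)%SET \in D i.
Proof.
move=> dP PP; have /finset.setIidPr <- : (\bigcap_(Phi in D i | P Phi) Phi)%SET \subset Psi.
  by apply: finset.bigcap_inf; rewrite dP.
apply: (big_rec (fun X => (Psi :&: X)%SET \in D i)); first by rewrite finset.setIT.
by move=> Phi X /andP[dPhi _] dX; rewrite finset.setICA; case: (D_lattice dPhi dX).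
Qed.

Lemma dlow_demand i : dlow D i \in D i.
Proof.
have [Psi dP] := D_ex i; have := @bigcap_demand i xpredT Psi dP isT.
by rewrite /dlow; under eq_bigl do rewrite andbT.
Qed.

(** Before step [s] only contracts outside [Hset] are removed, and [Hset] contains every
    [dlow D i]. *)
Lemma dlow_sub_Omega_at s i : verif_reaches N D s -> dlow D i \subset Omega_at N D s.
Proof.
case=> _ reach; have H k : (k < s)%N -> dlow D i \subset Omega_at N D k.+1.
  elim: k => [_|k IH ks]; first exact: finset.subsetT.
  rewrite Omega_atS // finset.subsetD IH 1?ltnW //= disjoint_sym.
  have /reach[_ GH] : (1 <= k.+1 < s)%N by rewrite ks.
  rewrite -finset.setI_eq0; apply/eqP/finset.setP=> w; rewrite finset.in_set0.
  apply/negP; rewrite finset.in_setI => /andP[wG wl].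
  have : w \in (Gset N D k.+1 :&: Hset D)%SET.
    by rewrite finset.in_setI wG finset.in_set; apply/existsP; exists i.
  by rewrite GH finset.in_set0.
by case: s reach H => [|s] _ H; [exact: finset.subsetT|exact: H].
Qed.

Lemma dup_demand s i : verif_reaches N D s -> dup N D s i \in D i.
Proof. by move=> reach; apply: dup_in_demand (dlow_demand i) (dlow_sub_Omega_at i reach). Qed.

(** Some participant still wants [w] at step [k.+1], hence also at step [k]; as [w] survived step
    [k], all participants wanted it there. *)
Lemma dup_prev k w j : (1 <= k)%N -> w \in Gset N D k.+1 -> j \in N w -> w \in dup N D k j.
Proof.
move=> k1 wG jw; have wO := fintype.subsetP (Gset_sub _) _ wG.
case/GsetP: wG => -[j' j'w /(fintype.subsetP (dup_anti j' (leqnSn k))) wj'] _.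
apply: dup_notin_Gset j'w jw wj'.
by move: wO; rewrite Omega_atS // finset.in_setD => /andP[].
Qed.

(* The least demand set containing w leaves Omega_at k.+1, although it is
   contained in Omega_at k. *)
Lemma complement_in_Gset k w j : (1 <= k)%N -> w \in Gset N D k.+1 -> j \in N w ->
  w \notin dup N D k.+1 j ->
  exists w', [/\ w' \in Gset N D k, w' \in dup N D k j & complement_to N D j w' w].
Proof.
move=> k1 wG jw wj; have wk := dup_prev k1 wG jw.
have wO := fintype.subsetP (Gset_sub _) _ wG.
have /mem_dup_in[Psi dP /andP[sP wP]] := wk.
set M := (\bigcap_(Phi in D j | w \in Phi) Phi)%SET.
have dM : M \in D j := @bigcap_demand j (fun Phi => w \in Phi) Psi dP wP.
have wM : w \in M by apply/finset.bigcapP=> Phi /andP[].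
have sMP : M \subset Psi by apply: finset.bigcap_inf; rewrite dP.
have : ~~ (M \subset Omega_at N D k.+1).
  by apply: contra wj => sM; apply/mem_dup_in; exists M; rewrite ?sM.
case/subsetPn=> w' w'M w'O; exists w'.
have w'Ok : w' \in Omega_at N D k.
  by apply: (fintype.subsetP sP); apply: (fintype.subsetP sMP).
move: w'O; rewrite Omega_atS // finset.in_setD w'Ok andbT negbK => w'G.
split=> //.
  apply/mem_dup_in; exists M => //; rewrite w'M andbT.
  exact: fintype.subset_trans sP.
split; first split.
- exact: fintype.subsetP (D_own dM) _ w'M.
- exact: fintype.subsetP (D_own dM) _ wM.
- by apply/eqP=> ww'; move: wO; rewrite Omega_atS // -ww' finset.in_setD w'G.
split; first by exists M.
by move=> Phi dPhi wPhi; apply: (fintype.subsetP (finset.bigcap_inf Phi _)) w'M; rewrite dPhi.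
Qed.

(** The chain is built backwards from its end: the complement [w'] given by [complement_in_Gset] is
    rejected one step earlier by some participant [j'], from whom the construction continues. *)
Lemma chain_prefix m w j : w \in Gset N D m.+1 -> j \in N w ->
  w \notin dup N D m.+1 j ->
  exists c : chain I Omega,
  [/\ ag c m.+1 = j /\ pc c m.+1 = w,
      forall l, (1 <= l <= m)%N ->
        pc c l \in (contracts_of N (ag c l) :&: contracts_of N (ag c l.+1))%SET,
      forall l, (1 <= l <= m)%N ->
        [/\ pc c l \in Gset N D l, pc c l \notin dup N D l (ag c l) &
            pc c l \in dup N D l (ag c l.+1)] &
      forall l, (2 <= l <= m.+1)%N -> complement_to N D (ag c l) (pc c l.-1) (pc c l)].
Proof.
elim: m w j => [|m IH] w j wG jw wj.
  by exists (Chain (fun=> j) (fun=> w)); split=> // l; lia.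
have [w' [w'G w'j compl]] := complement_in_Gset (ltn0Sn m) wG jw wj.
have /GsetP[_ [j' j'w' w'j']] := w'G.
have [c [[agc pcc] own step comp]] := IH w' j' w'G j'w' w'j'.
pose upd T (f : nat -> T) (x : T) l := if l == m.+2 then x else f l.
exists (Chain (upd _ (ag c) j) (upd _ (pc c) w)).
have updE T (f : nat -> T) x l : (l < m.+2)%N -> upd T f x l = f l.
  by rewrite /upd ltn_neqAle => /andP[/negbTE ->].
have updM T (f : nat -> T) x : upd T f x m.+2 = x by rewrite /upd eqxx.
split=> [|l|l|l] /=; first by rewrite !updM.
- case/andP=> l1; rewrite leq_eqVlt => /orP[/eqP ->|lm].
    rewrite !updM !updE // pcc agc !finset.in_setI !finset.in_set j'w' /=.
    by case: compl => -[]; rewrite finset.in_set.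
  by rewrite !updE; try lia; apply: own; lia.
- case/andP=> l1; rewrite leq_eqVlt => /orP[/eqP ->|lm].
    by rewrite !updM !updE // pcc agc.
  by rewrite !updE; try lia; apply: step; lia.
case/andP=> l1; rewrite leq_eqVlt => /orP[/eqP ->|lm].
  by rewrite /= !updM updE // pcc.
by rewrite !updE //; [apply: comp|]; lia.
Qed.

(** A prefix ending at some [w] in [Gset] and [Hset] is closed by an agent [i] with [w] in
    [dlow D i]. That set is still available at step [s], so [i] wants [w] there. *)
Lemma chain_exists s : declares_noneq N D s -> exists c, complements_chain N D s c.
Proof.
case=> reach /finset.set0Pn[w]; rewrite finset.in_setI => /andP[wG wH].
have [i wi] : exists i, w \in dlow D i by move: wH; rewrite finset.in_set => /existsP.
have iw : w \in contracts_of N i by apply: fintype.subsetP (D_own (dlow_demand i)) _ wi.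
have wdi : w \in dup N D s i.
  apply/mem_dup_in; exists (dlow D i); rewrite ?dlow_demand //.
  by rewrite wi dlow_sub_Omega_at.
have /GsetP[_ [j jw wj]] := wG.
case: s reach wG wdi wj => [[]//|m] reach wG wdi wj.
have [c [[agc pcc] own step comp]] := chain_prefix wG jw wj.
pose ag' l := if l == m.+2 then i else ag c l.
have agE l : (l < m.+2)%N -> ag' l = ag c l.
  by rewrite /ag' ltn_neqAle => /andP[/negbTE ->].
have agM : ag' m.+2 = i by rewrite /ag' eqxx.
exists (Chain ag' (pc c)); split=> [l|l||l] /=.
- case/andP=> l1; rewrite leq_eqVlt => /orP[/eqP ->|lm].
    by rewrite agM agE // pcc agc finset.in_setI iw finset.in_set jw.
  by rewrite !agE; try lia; apply: own; lia.
- case/andP=> l1; rewrite leq_eqVlt => /orP[/eqP ->|lm].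
    by rewrite agM agE // pcc agc.
  by rewrite !agE; try lia; apply: step; lia.
- by rewrite agM pcc.
by case/andP=> l1 lm; rewrite agE //; apply: comp; rewrite l1.
Qed.

(** As long as [Theta] is available, each participant of a contract in [Theta] has a demand set
    containing it, so none rejects it and it stays. *)
Lemma common_demand_sub_Omega_at Theta s :
  (forall i, (Theta :&: contracts_of N i)%SET \in D i) -> Theta \subset Omega_at N D s.
Proof.
move=> dT; elim: s => [|[_|s IH]]; try exact: finset.subsetT.
rewrite Omega_atS // finset.subsetD IH /= -finset.setI_eq0.
apply/eqP/finset.setP=> w; rewrite finset.in_set0 finset.in_setI.
apply/negP => /andP[wT /GsetP[_ [j jw /negP]]]; apply.
apply/mem_dup_in; exists (Theta :&: contracts_of N j)%SET => //.
by rewrite (fintype.subset_trans (finset.subsetIl _ _) IH) finset.in_setI wT finset.in_set.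
Qed.

End Verification.

(** * Each price update lowers the sum of the indirect utilities *)

Lemma int_num_lt1 (R : archiRealDomainType) (x y : R) :
  x \is a Num.int -> y \is a Num.int -> x < y -> x + 1 <= y.
Proof.
move=> /intrP[m ->] /intrP[n ->]; rewrite ltr_int -lezD1 => le.
by rewrite -[1]/(1%:~R) -intrD ler_int.
Qed.

Section Descent.
Variables (R : realType) (I Omega : finType) (N : Omega -> {set I}).
Variables (v : I -> {set Omega} -> R) (p : price R I Omega).
Implicit Types (Psi : {set Omega}) (w : Omega) (i : I) (s : nat).

Let D : reports I Omega := fun i => demand N v i (p i).

Hypothesis gc : forall i, gross_complements N v i.
Hypothesis v_int : forall i, integer_valued N v i.
Hypothesis p_int : integral_price N p.

Lemma net_value_int i Psi : Psi \subset contracts_of N i ->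
  net_value v i (p i) Psi \is a Num.int.
Proof.
move=> sP; rewrite /net_value rpredB ?v_int // rpred_sum // => w wP; apply: p_int.
by have := fintype.subsetP sP _ wP; rewrite finset.in_set.
Qed.

Lemma indirect_utility_int i : indirect_utility N v i (p i) \is a Num.int.
Proof.
by have [Psi /demandP[sP <-]] := demand_exists N v i (p i); apply: net_value_int.
Qed.

(** Integrality turns a strict loss into a loss of one unit, which is exactly the size of a price
    change. *)
Lemma net_value_not_demanded i Psi : Psi \subset contracts_of N i -> Psi \notin D i ->
  net_value v i (p i) Psi + 1 <= indirect_utility N v i (p i).
Proof.
move=> sP dP; apply: int_num_lt1; rewrite ?indirect_utility_int ?net_value_int //.
rewrite lt_neqAle indirect_utility_ub // andbT.
by apply: contra dP => /eqP eP; apply/demandP.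
Qed.

Section OneChain.
Variables (s : nat) (c : chain I Omega).
Hypothesis s_gt0 : (0 < s)%N.
Hypothesis chain_c : complements_chain N D s c.

(* The price change of the chain at its l-th agent makes Psi cheaper by
   chain_gain l Psi, up to the unit that its last agent loses for sure. *)
Definition chain_gain (l : nat) Psi : R :=
  ((l == s.+1) || (pc c l \in Psi))%:R - ((1 < l)%N && (pc c l.-1 \in Psi))%:R.

Let own_step l : (1 <= l <= s)%N -> ag c l \in N (pc c l) /\ ag c l.+1 \in N (pc c l).
Proof.
case: chain_c => own _ _ _ /own; rewrite finset.in_setI !finset.in_set.
by case/andP.
Qed.

(* The bound is proved for all sets at once: if Psi gains at step m then, by
   supermodularity with the demand set B of the agent within Omega_at m.-1, the
   unit is lost by Psi :&: B, and the earlier gains of Psi are those of Psi :|: B. *)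
Lemma chain_gain_le i m Psi : (m <= s.+1)%N -> Psi \subset contracts_of N i ->
  net_value v i (p i) Psi + \sum_(1 <= l < m.+1 | ag c l == i) chain_gain l Psi
    <= indirect_utility N v i (p i).
Proof.
have [own step [_ low] compl] := chain_c.
elim: m Psi => [|m IH] Psi ms sP; first by rewrite big_geq // addr0 indirect_utility_ub.
rewrite big_mkcond big_nat_recr //= -big_mkcond /= addrA.
case: (eqVneq (ag c m.+1) i) => [agi|_]; last by rewrite addr0 IH // ltnW.
rewrite {2}/chain_gain.
case: (boolP ((m.+1 == s.+1) || (pc c m.+1 \in Psi))) => gain; last first.
  apply: le_trans (IH Psi (ltnW ms) sP); rewrite gerDl.
  by case: (_ && _); rewrite /= ?subr0 ?sub0r ?lerN10.
case: (boolP ((1 < m.+1)%N && (pc c m.+1.-1 \in Psi))) => [_|loss].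
  by rewrite subrr addr0 IH // ltnW.
rewrite subr0; case: m IH ms agi gain loss => [|m] IH ms agi gain loss.
  (* At step 1 every contract is available, so the first agent has no demand set at all containing
     [pc c 1]. *)
  rewrite big_geq // addr0; apply: net_value_not_demanded => //.
  apply/negP=> dP; move: gain; rewrite eqSS.
  rewrite eq_sym gtn_eqF //= => wP.
  have [_ /negP + _] := step 1%N s_gt0; apply; rewrite agi.
  by apply/mem_dup_in; exists Psi; rewrite ?finset.subsetT.
have {}loss : pc c m.+1 \notin Psi by [].
have ms1 : (1 <= m.+1 <= s)%N := ms.
have [wG _ wB] := step _ ms1.
set B := dup N D m.+1 i.
have dB : B \in D i.
  rewrite agi in wB; case/mem_dup_in: wB => Phi dPhi /andP[sPhi _].
  by apply: dup_in_demand dPhi sPhi => j; apply: demand_lattice.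
have /demandP[sB eB] := dB.
have sI : (Psi :&: B)%SET \subset contracts_of N i.
  by rewrite (fintype.subset_trans (finset.subsetIl _ _)).
have sU : (Psi :|: B)%SET \subset contracts_of N i by rewrite finset.subUset sP.
have wI : pc c m.+1 \notin (Psi :&: B)%SET by rewrite finset.in_setI (negbTE loss).
(* The intersection lacks [pc c m.+1]. For the last agent this contract lies in all demand sets; for
   any other it is a complement to [pc c m.+2], which is in [Psi], and in [B] by [dup_prev]. *)
have dI : (Psi :&: B)%SET \notin D i.
  apply/negP => dI; move: wI => /negP; apply.
  have [ems|nms] := eqVneq m.+2 s.+1.
    move: low; case: ems => <-; rewrite agi => /finset.bigcapP; exact.
  have ms2 : (1 <= m.+2 <= s)%N by rewrite /= -ltnS ltn_neqAle nms.
  have [_ [_]] := compl m.+2 ms2; rewrite agi /=; apply=> //.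
  move: gain; rewrite (negbTE nms) finset.in_setI /= => -> /=.
  have [w'G _ _] := step _ ms2; apply: (dup_prev _ w'G) => //.
  by rewrite -agi; case: (own_step ms2).
have := net_value_supermodular (gc (i := i)) (p i) sP sB.
have := net_value_not_demanded sI dI; have := IH _ (ltnW ms) sU.
(* [B] contains no contract entering these gains: [pc c l] is rejected by [i] at step [l], and
   [pc c l.-1] is removed before step [m.+1]. *)
have -> : \sum_(1 <= l < m.+2 | ag c l == i) chain_gain l (Psi :|: B)%SET =
   \sum_(1 <= l < m.+2 | ag c l == i) chain_gain l Psi.
  rewrite big_nat_cond [RHS]big_nat_cond; apply: eq_bigr => l /andP[/andP[l1 lm] /eqP agl].
  have lm1 : (l <= m.+1)%N by [].
  have ls : (1 <= l <= s)%N by rewrite l1 (leq_trans lm1).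
  rewrite /chain_gain !finset.in_setU; congr ((_ || _)%:R - _%:R).
    have [_ wl _] := step _ ls; rewrite [X in _ || X](_ : _ = false) ?orbF //.
    apply/negbTE; apply: contra wl; rewrite agl.
    by apply: fintype.subsetP; apply: dup_anti.
  case: l lm1 ls {l1 lm agl} => [|[|l]] //= lm1 ls.
  rewrite [X in _ || X](_ : _ = false) ?orbF //.
  have [wl _ _] := step l.+1 (ltnW ls).
  apply/negP => /(fintype.subsetP (dup_in_sub _ _ _)).
  move/(fintype.subsetP (Omega_at_anti _ _ lm1)).
  by rewrite Omega_atS // finset.in_setD wl.
rewrite eB mulr1n; lra.
Qed.

(** Price decreases are indexed by [l] and increases by [l.+1]. The final term takes back the unit
    that [chain_gain] credits unconditionally at index [s.+1]. *)
Lemma net_value_chain i Psi : Psi \subset contracts_of N i ->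
  net_value v i (fun w => p i w + price_change R s c i w) Psi =
  net_value v i (p i) Psi + \sum_(1 <= l < s.+2 | ag c l == i) chain_gain l Psi
    - (ag c s.+1 == i)%:R.
Proof.
move=> sP; rewrite /net_value big_split /=.
have -> : \sum_(w in Psi) price_change R s c i w =
    \sum_(1 <= l < s.+1) ((ag c l.+1 == i) && (pc c l \in Psi))%:R
    - \sum_(1 <= l < s.+1) ((ag c l == i) && (pc c l \in Psi))%:R.
  rewrite /price_change exchange_big -sumrB /=; apply: eq_bigr => l _.
  have cnt j : \sum_(w in Psi) ((j, pc c l) == (i, w))%:R =
      ((j == i) && (pc c l \in Psi))%:R :> R.
    case: (boolP (pc c l \in Psi)) => lP; rewrite ?andbT ?andbF.
      rewrite (bigD1 (pc c l)) //= big1 ?addr0 => [|w /andP[_ wl]].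
        by rewrite xpair_eqE eqxx andbT.
      by rewrite xpair_eqE [pc c l == w]eq_sym (negbTE wl) andbF.
    rewrite big1 // => w wP; rewrite xpair_eqE [pc c l == w](_ : _ = false) ?andbF //.
    by apply/eqP=> lw; rewrite lw wP in lP.
  by rewrite sumrB !cnt.
have -> : \sum_(1 <= l < s.+2 | ag c l == i) chain_gain l Psi =
    \sum_(1 <= l < s.+2 | ag c l == i) ((l == s.+1) || (pc c l \in Psi))%:R
    - \sum_(1 <= l < s.+2 | ag c l == i) ((1 < l)%N && (pc c l.-1 \in Psi))%:R.
  by rewrite -sumrB.
have -> : \sum_(1 <= l < s.+2 | ag c l == i) ((l == s.+1) || (pc c l \in Psi))%:R =
    \sum_(1 <= l < s.+1) ((ag c l == i) && (pc c l \in Psi))%:R + (ag c s.+1 == i)%:R :> R.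
  rewrite big_mkcond big_nat_recr //= eqxx /=; congr (_ + _); last by case: eqP.
  rewrite big_nat_cond [RHS]big_nat_cond; apply: eq_bigr => l /andP[/andP[_ ls] _].
  by rewrite ltn_eqF //=; case: eqP.
have -> : \sum_(1 <= l < s.+2 | ag c l == i) ((1 < l)%N && (pc c l.-1 \in Psi))%:R =
    \sum_(1 <= l < s.+1) ((ag c l.+1 == i) && (pc c l \in Psi))%:R :> R.
  rewrite big_mkcond big_nat_recl //= [X in X + _](_ : _ = 0) ?add0r; last by case: eqP.
  by rewrite big_nat_cond [RHS]big_nat_cond; apply: eq_bigr => l /andP[/andP[l1 _] _];
    rewrite ltnS l1 /=; case: eqP.
lra.
Qed.

Lemma chain_indirect_utility i :
  indirect_utility N v i (fun w => p i w + price_change R s c i w)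
    <= indirect_utility N v i (p i) - (ag c s.+1 == i)%:R.
Proof.
have [Psi /demandP[sP <-]] := demand_exists N v i (fun w => p i w + price_change R s c i w).
by rewrite net_value_chain // lerD2r chain_gain_le.
Qed.

End OneChain.

Lemma price_change_out s c i w :
  (forall l, (1 <= l <= s.+1)%N -> ag c l != i) -> price_change R s c i w = 0.
Proof.
move=> out; rewrite /price_change big_nat_cond big1 // => l /andP[/andP[l1 ls] _].
by rewrite !xpair_eqE !(negbTE (out _ _)) ?subrr //; lia.
Qed.

(** Disjointness puts each agent in at most one chain, so the bound for a single chain applies agent
    by agent. Each of the [m] chains has one last agent, hence a total drop of at least [m]. *)
Lemma price_update_descent p' : price_update N D p p' ->
  \sum_i indirect_utility N v i (p' i) + 1 <= \sum_i indirect_utility N v i (p i).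
Proof.
move=> [s [[[s_gt0 _] _] [m [c [m_gt0 chains disj p'E]]]]].
have ind i : indirect_utility N v i (p' i) <=
    indirect_utility N v i (p i) - \sum_(a < m) (ag (c a) s.+1 == i)%:R.
  have [Psi /demandP[sP <-]] := demand_exists N v i (p' i).
  (* The update prescribes [p'] only at participants, which suffices because [Psi] consists of
     contracts of [i]. *)
  have eqnet : net_value v i (p' i) Psi =
      net_value v i (fun w => p i w + \sum_(a < m) price_change R s (c a) i w) Psi.
    congr (_ - _); apply: eq_bigr => w wP; apply: p'E.
    by have := fintype.subsetP sP _ wP; rewrite finset.in_set.
  rewrite eqnet.
  have [[a [l ls agl]]|nin] :=
    pselect (exists a, exists2 l, (1 <= l <= s.+1)%N & ag (c a) l = i).
    have out b : b != a -> forall l', (1 <= l' <= s.+1)%N -> ag (c b) l' != i.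
      by move=> ba l' ls'; rewrite -agl; apply: (disj b a).
    have -> : \sum_(b < m) (ag (c b) s.+1 == i)%:R = (ag (c a) s.+1 == i)%:R :> R.
      rewrite (bigD1 a) //= big1 ?addr0 // => b ba.
      by rewrite (negbTE (out b ba _ _)) // ltnSn.
    apply: le_trans (chain_indirect_utility s_gt0 (chains a) i).
    rewrite (_ : net_value _ _ _ _ =
      net_value v i (fun w => p i w + price_change R s (c a) i w) Psi) ?indirect_utility_ub //.
    congr (_ - _); apply: eq_bigr => w _; congr (_ + _).
    rewrite (bigD1 a) //= big1 ?addr0 // => b ba.
    by apply: price_change_out; apply: out.
  have out b l' : (1 <= l' <= s.+1)%N -> ag (c b) l' != i.
    by move=> ls'; apply/eqP => agl; apply: nin; exists b, l'.
  have -> : \sum_(b < m) (ag (c b) s.+1 == i)%:R = 0 :> R.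
    by rewrite big1 // => b _; rewrite (negbTE (out b _ _)) // ltnSn.
  rewrite subr0.
  rewrite (_ : net_value _ _ _ _ = net_value v i (p i) Psi) ?indirect_utility_ub //.
  congr (_ - _); apply: eq_bigr => w _; rewrite big1 ?addr0 // => b _.
  by apply: price_change_out; apply: out.
have : \sum_i indirect_utility N v i (p' i) <=
    \sum_i (indirect_utility N v i (p i) - \sum_(a < m) (ag (c a) s.+1 == i)%:R).
  by apply: ler_sum.
rewrite [X in _ <= X -> _]sumrB exchange_big /=.
have -> : \sum_(a < m) \sum_i (ag (c a) s.+1 == i)%:R = m%:R :> R.
  rewrite -[m in RHS]card_ord -sumr_const; apply: eq_bigr => a _.
  rewrite (bigD1 (ag (c a) s.+1)) //= eqxx big1 ?addr0 // => i ia.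
  by rewrite eq_sym (negbTE ia).
have : 1 <= m%:R :> R by rewrite ler1n.
lra.
Qed.

End Descent.

(** * Price updates preserve integrality and balance *)

Section PriceUpdate.
Variables (R : realType) (I Omega : finType) (N : Omega -> {set I}).
Variables (D : reports I Omega) (p p' : price R I Omega).

Lemma price_update_int :
  price_update N D p p' -> integral_price N p -> integral_price N p'.
Proof.
move=> [s [_ [m [c [_ _ _ p'E]]]]] p_int i w iw.
rewrite p'E // rpredD ?p_int // rpred_sum // => a _.
by rewrite rpred_sum // => l _; rewrite rpredB ?rpred_nat.
Qed.

(** Each link of a chain moves one unit between two participants of the same primitive contract. *)
Lemma price_update_balanced : price_update N D p p' -> balanced N p -> balanced N p'.
Proof.
move=> [s [_ [m [c [_ chains _ p'E]]]]] p_bal w.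
rewrite (eq_bigr _ (fun i iw => p'E i w iw)) big_split /= p_bal add0r exchange_big /=.
rewrite big1 // => a _; rewrite exchange_big /= big_nat_cond big1 // => l /andP[ls _].
have [own _ _ _] := chains a; have := own l ls.
rewrite finset.in_setI !finset.in_set => /andP[in1 in2].
have cnt j : j \in N (pc (c a) l) ->
    \sum_(i in N w) ((j, pc (c a) l) == (i, w))%:R = (pc (c a) l == w)%:R :> R.
  move=> jl; case: (eqVneq (pc (c a) l) w) jl => [<- jl|lw jl].
    rewrite (bigD1 j) //= eqxx big1 ?addr0 // => i /andP[_ ij].
    by rewrite xpair_eqE eq_sym (negbTE ij).
  by rewrite big1 // => i _; rewrite xpair_eqE (negbTE lw) andbF.
by rewrite sumrB !cnt // subrr.
Qed.

End PriceUpdate.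

(** * Contracts, payments and utilities in terms of prices *)

Section Contracts.
Variables (R : realType) (I Omega : finType) (N : Omega -> {set I}).
Implicit Types (x y : Defs.contract R N) (Y Z S : set (Defs.contract R N)) (i : I) (w : Omega).

Lemma sum_subtype_payment w (t : {ffun {i : I | i \in N w} -> R}) :
  \sum_(i in N w) (if insub i is Some j then t j else 0) = \sum_j t j.
Proof.
rewrite (reindex_omap (val : {i : I | i \in N w} -> I) insub) => [|i iw]; last first.
  by rewrite insubT /=.
apply: eq_big => [j|j _]; first by rewrite (valP j) valK eqxx.
by rewrite valK.
Qed.

Lemma sum_payment x : \sum_(i in N (tau x)) payment x i = 0.
Proof. by case: x => [[w t] t0]; rewrite /payment /= sum_subtype_payment; apply/eqP. Qed.

Lemma contract_eq x y : tau x = tau y ->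
  (forall i, i \in N (tau x) -> payment x i = payment y i) -> x = y.
Proof.
case: x y => [[w t] t0] [[w' t'] t'0]; rewrite /tau /= => ww'; subst w'.
rewrite /payment /= => pay; apply: val_inj => /=; congr existT.
by apply/ffunP=> j; have := pay (val j) (valP j); rewrite valK.
Qed.

Lemma contract_at (p : price R I Omega) w : balanced N p ->
  exists2 x : Defs.contract R N, tau x = w & forall i, i \in N w -> payment x i = p i w.
Proof.
move=> p_bal; pose t : {ffun {i : I | i \in N w} -> R} := [ffun j => p (val j) w].
have t0 : \sum_j t j == 0.
  apply/eqP; rewrite -sum_subtype_payment -[RHS](p_bal w); apply: eq_bigr => i iw.
  by rewrite insubT ffunE.
exists (exist _ (Tagged _ t) t0) => // i iw.
by rewrite /payment /= insubT ffunE.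
Qed.

Lemma prims_involving Y i :
  (prims Y :&: contracts_of N i)%SET = prims (involving Y i).
Proof.
apply/finset.setP=> w; rewrite finset.in_setI !finset.in_set.
apply/andP/asboolP => [[/asboolP[x Yx <-] iw]|[x [Yx ix] <-]]; first by exists x.
by split=> //; apply/asboolP; exists x.
Qed.

Lemma involvingK Y i : involving (involving Y i) i = involving Y i.
Proof. by apply/seteqP; split=> x [] // []. Qed.

(** [tau] is injective on [involving Y i], so the sum over contracts becomes one over primitive
    contracts. The prices [g] are left free so that sets mixing output and blocking terms are
    covered. *)
Lemma utility_net_value (v : I -> {set Omega} -> R) i Y (g : Omega -> R) :
  distinct_prims (involving Y i) ->
  (forall x, involving Y i x -> payment x i = g (tau x)) ->
  utility v i Y = (net_value v i g (prims (involving Y i)))%:E.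
Proof.
move=> dY payE; rewrite /utility asboolT // prims_involving; congr (_ - _)%:E.
have -> : \sum_(x \in involving Y i) payment x i =
    \sum_(x \in involving Y i) g (tau x).
  by apply: eq_fsbigr => x /set_mem; apply: payE.
rewrite -(fsbig_image (involving Y i) (@tau R I Omega N) g); last first.
  by move=> x y /set_mem Yx /set_mem Yy; apply: dY.
rewrite [X in \big[_/_]_(_ \in X) _](_ : _ = [set` enum (prims (involving Y i))]); last first.
  apply/seteqP; split=> w /=; rewrite mem_enum finset.in_set.
    by case=> x Yx <-; apply/asboolP; exists x.
  by move/asboolP => [x Yx <-]; exists x.
by rewrite -fsbig_seq ?enum_uniq // big_enum.
Qed.

End Contracts.

(** * Stability of the output of the verification procedure *)

Section Stability.
Variables (R : realType) (I Omega : finType) (N : Omega -> {set I}).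
Variables (v : I -> {set Omega} -> R) (p : price R I Omega) (s : nat).
Implicit Types (x y z : Defs.contract R N) (Y Z S : set (Defs.contract R N)).
Implicit Types (i : I) (w : Omega).

Let D : reports I Omega := fun i => demand N v i (p i).
Let out : set (Defs.contract R N) := verif_output D p s.
Let Phi : {set Omega} := (\bigcup_i dup N D s i)%SET.

Hypothesis N_gt0 : forall w, exists i, i \in N w.
Hypothesis gc : forall i, gross_complements N v i.
Hypothesis p_bal : balanced N p.
Hypothesis eq_s : declares_eq N D s.

Let dup_opt i : dup N D s i \in D i.
Proof.
apply: (@dup_demand _ _ N); last by case: eq_s.
- by move=> j; apply: demand_exists.
- by move=> j Psi Psi'; apply: demand_lattice.
Qed.

(** With [Gset] empty at step [s], the participants agree on each contract, so the individual demand
    sets are traces of the single set [Phi]. *)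
Let dupE i : (Phi :&: contracts_of N i)%SET = dup N D s i.
Proof.
have own j : dup N D s j \subset contracts_of N j by have /demandP[] := dup_opt j.
apply/finset.setP=> w; rewrite finset.in_setI; apply/andP/idP => [[]|wi].
  case/finset.bigcupP=> j _ wj; rewrite finset.in_set => iw.
  apply: (dup_notin_Gset _ _ iw wj); first by case: eq_s => _ ->; rewrite finset.in_set0.
  by have := fintype.subsetP (own j) _ wj; rewrite finset.in_set.
by split; [apply/finset.bigcupP; exists i | apply: fintype.subsetP wi].
Qed.

Let mem_out x : out x <->
  tau x \in Phi /\ forall i, i \in N (tau x) -> payment x i = p i (tau x).
Proof.
split=> -[H1 H2]; split=> //; first by case: H1 => i xi; apply/finset.bigcupP; exists i.
by case/finset.bigcupP: H1 => i _ xi; exists i.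
Qed.

Lemma verif_output_distinct : distinct_prims out.
Proof.
move=> x y /mem_out[_ px] /mem_out[_ py] xy; apply: contract_eq => // i ix.
by rewrite px // py -?xy.
Qed.

Let prims_out i : prims (involving out i) = dup N D s i.
Proof.
rewrite -dupE -prims_involving; congr (_ :&: _)%SET.
apply/finset.setP=> w; rewrite finset.in_set; apply/asboolP/idP.
  by case=> x /mem_out[xPhi _] <-.
move=> wPhi; have [x xw px] := contract_at w p_bal.
by exists x => //; apply/mem_out; rewrite xw.
Qed.

Lemma involving_id Y i : (forall x, Y x -> i \in N (tau x)) -> involving Y i = Y.
Proof. by move=> iY; apply/seteqP; split=> x; [case | move=> Yx; split=> //; apply: iY]. Qed.

Lemma prims_involving_own Y i : prims (involving Y i) \subset contracts_of N i.
Proof. by rewrite -prims_involving finset.subsetIr. Qed.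

Let utility_out i Y : Y `<=` out ->
  utility v i Y = (net_value v i (p i) (prims (involving Y i)))%:E.
Proof.
move=> sY; apply: utility_net_value => [x y [/sY ox _] [/sY oy _]|x [/sY/mem_out[_ px] ix]].
  exact: verif_output_distinct.
exact: px.
Qed.

Let sub_involving Y i : involving Y i `<=` Y.
Proof. by move=> x []. Qed.

Let utility_out_max i :
  utility v i (involving out i) = (indirect_utility N v i (p i))%:E.
Proof.
rewrite utility_out; last exact: sub_involving.
by rewrite involvingK prims_out; have /demandP[_ ->] := dup_opt i.
Qed.

Lemma verif_output_rational : individually_rational v out.
Proof.
move=> i; split=> // S sS; rewrite utility_out_max utility_out.
  by rewrite lee_fin indirect_utility_ub // prims_involving_own.
by move=> x /sS[].
Qed.

Section Blocking.
Variable Z : set (Defs.contract R N).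
Hypothesis Z_blocks : blocks v Z out.

Let chosen i Y' := [/\ Y' `<=` involving out i `|` involving Z i,
  involving Z i `<=` Y', distinct_prims Y' &
  forall S, S `<=` involving out i `|` involving Z i -> (utility v i S <= utility v i Y')%E].

(** An optimal choice is at least as good as the output, whose utility is finite, so its primitive
    contracts must be distinct. *)
Let choice_ex i : participants Z i -> exists Y', chosen i Y'.
Proof.
have [_ _ block] := Z_blocks; case/block=> [Y' [sub opt] ZY']; exists Y'; split=> //.
have Y'i : involving Y' i = Y'.
  by apply: involving_id => x /sub[[]|[]].
have := opt (involving out i) (@subsetUl _ _ _).
rewrite utility_out_max /utility; case: asboolP => //.
by rewrite Y'i.
Qed.

Let partZ z i : Z z -> i \in N (tau z) -> participants Z i.
Proof. by move=> Zz iz; exists z. Qed.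

Let Z_distinct : distinct_prims Z.
Proof.
move=> z z' Zz Zz' zz'; have [i iz] := N_gt0 (tau z).
have [Y' [_ ZY' dY' _]] := choice_ex (partZ Zz iz).
by apply: dY' => //; apply: ZY'; split=> //; rewrite -zz'.
Qed.

(* The prices at which the contracts of Z, and all those of the output with
   other primitive contracts, are concluded. *)
Definition blocking_price (i : I) (w : Omega) : R :=
  if pselect (exists2 z, Z z & tau z = w) is left e then
    payment (projT1 (cid2 e)) i
  else p i w.

Let blocking_priceE z i : Z z -> blocking_price i (tau z) = payment z i.
Proof.
move=> Zz; rewrite /blocking_price; case: pselect => [e|[]]; last by exists z.
by case: cid2 => z' /= Zz' zz'; rewrite (Z_distinct Zz' Zz zz').
Qed.

Let blocking_price_out i w : w \notin prims Z -> blocking_price i w = p i w.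
Proof.
rewrite finset.in_set => /asboolPn nZ; rewrite /blocking_price.
by case: pselect.
Qed.

Let blocking_price_bal : balanced N blocking_price.
Proof.
move=> w; have [wZ|wZ] := boolP (w \in prims Z).
  move: wZ; rewrite finset.in_set => /asboolP[z Zz <-].
  by rewrite -[RHS](sum_payment z); apply: eq_bigr => i _; rewrite blocking_priceE.
by rewrite -[RHS](p_bal w); apply: eq_bigr => i _; rewrite blocking_price_out.
Qed.

Let chosen_involving i Y' x : chosen i Y' -> Y' x -> i \in N (tau x).
Proof. by case=> sub _ _ _ /sub[[]|[]]. Qed.

(** An output contract in [Y'] cannot share its primitive contract with some [z] in [Z]: both would
    lie in [Y'] and coincide, but [Z] avoids the output. *)
Let payment_chosen i Y' x : chosen i Y' -> Y' x -> payment x i = blocking_price i (tau x).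
Proof.
move=> [sub ZY' dY' _] Y'x; case: (sub _ Y'x) => -[]; last first.
  by move=> Zx _; rewrite blocking_priceE.
move=> ox ix; rewrite blocking_price_out; first by case/mem_out: ox => _; apply.
rewrite finset.in_set; apply/asboolPn => -[z Zz zx].
have Y'z : Y' z by apply: ZY'; split=> //; rewrite zx.
by case: Z_blocks => _ /(_ z Zz) + _; apply; rewrite (dY' z x).
Qed.

Let utility_chosen i Y' : chosen i Y' ->
  utility v i Y' = (net_value v i (blocking_price i) (prims Y'))%:E.
Proof.
move=> cY'; have Y'i : involving Y' i = Y'.
  by apply: involving_id => x; apply: chosen_involving.
have -> := @utility_net_value _ _ _ _ v i Y' (blocking_price i).
- by rewrite Y'i.
- by rewrite Y'i; case: cY'.
- by rewrite Y'i => x; apply: payment_chosen.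
Qed.

(* If z is concluded at other terms in the output, some participant pays more
   in z, and prefers to keep the contract of the output instead. *)
Let Z_new z : Z z -> tau z \notin Phi.
Proof.
move=> Zz; apply/negP => zPhi; set w := tau z in zPhi.
have [i iw lti] : exists2 i, i \in N w & p i w < payment z i.
  (* Otherwise the differences [p i w - payment z i] are nonnegative with sum zero, so all vanish
     and [z] belongs to the output. *)
  apply: contrapT => none.
  have le i : i \in N w -> 0 <= p i w - payment z i.
    move=> iw; rewrite subr_ge0 leNgt; apply/negP => lt; apply: none.
    by exists i.
  have sum0 : \sum_(i in N w) (p i w - payment z i) = 0.
    by rewrite sumrB p_bal sum_payment subrr.
  have eq0 := psumr_eq0P le sum0.
  case: Z_blocks => _ /(_ z Zz) + _; apply; apply/mem_out; split=> // i iw.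
  by apply/esym/eqP; rewrite -subr_eq0 eq0.
have [Y' cY'] := choice_ex (partZ Zz iw).
have [sub ZY' dY' opt] := cY'.
have Y'z : Y' z by apply: ZY'.
have [y yw py] := contract_at w p_bal.
have oy : out y by apply/mem_out; rewrite yw.
(* [S] is [Y'] with [z] replaced by the output contract [y] on the same [w], so only the payment of
   [i] for [w] changes. *)
pose S := [set x | (Y' x /\ x <> z) \/ x = y].
pose g w' := if w' == w then p i w else blocking_price i w'.
have iS x : S x -> i \in N (tau x).
  by case=> [[Y'x _]|->]; [apply: chosen_involving Y'x | rewrite yw].
have sS : S `<=` involving out i `|` involving Z i.
  by move=> x [[Y'x _]|->]; [exact: sub | left; split=> //; rewrite yw].
have Y'w x : Y' x -> x <> z -> tau x <> w.
  by move=> Y'x xz xw; apply: xz; apply: dY'.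
have dS : distinct_prims S.
  move=> x x' [[Y'x xz]|->] [[Y'x' x'z]|->] xx' //; first exact: dY'.
    by case: (Y'w x) => //; rewrite xx'.
  by case: (Y'w x') => //; rewrite -xx'.
have primsS : prims S = prims Y'.
  apply/finset.setP=> w'; rewrite !finset.in_set; apply/asboolP/asboolP => -[x].
    by case=> [[Y'x _] <-|-> <-]; [exists x | exists z; rewrite ?yw].
  move=> Y'x <-; have [->|xz] := pselect (x = z); last by exists x => //; left.
  by exists y => //; right.
have uS : utility v i S = (net_value v i g (prims S))%:E.
  rewrite (@utility_net_value _ _ _ _ v i S g) involving_id // => x.
  case=> [[Y'x xz]|->]; rewrite /g.
    by rewrite (negbTE (introN eqP (Y'w x Y'x xz))); apply: payment_chosen Y'x.
  by rewrite yw eqxx py.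
have := opt S sS; rewrite uS (utility_chosen cY') lee_fin primsS leNgt => /negP; apply.
have wY' : w \in prims Y' by rewrite finset.in_set; apply/asboolP; exists z.
rewrite /net_value ltrD2l ltrN2 (bigD1 w) //= [ltRHS](bigD1 w) //=.
rewrite /g eqxx (blocking_priceE _ Zz) (eq_bigr (blocking_price i)) ?ltrD2r //.
by move=> w' /andP[_ /negbTE ->].
Qed.

Let surcharge i : R :=
  \sum_(w in (prims Z :&: contracts_of N i)%SET) (blocking_price i w - p i w).

Let sum_surcharge : \sum_i surcharge i = 0.
Proof.
rewrite /surcharge (exchange_big_dep (fun w => w \in prims Z)) /=; last first.
  by move=> i w _; rewrite finset.in_setI => /andP[].
rewrite big1 // => w wZ; rewrite (eq_bigl (fun i => i \in N w)) => [|i].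
  by rewrite sumrB blocking_price_bal p_bal subrr.
by rewrite finset.in_setI wZ finset.in_set.
Qed.

(** For a member of [Z], [Psi] comes from her chosen set, which is worth at least the output;
    [blocking_price] and [p] differ only on [prims Z], whence the surcharge. For other agents the
    surcharge is zero and the output set serves. *)
Let blocking_demand i : exists Psi : {set Omega},
  [/\ Psi \subset contracts_of N i, (prims Z :&: contracts_of N i)%SET \subset Psi,
      Psi \subset (Phi :|: prims Z)%SET &
      indirect_utility N v i (p i) <= net_value v i (p i) Psi - surcharge i].
Proof.
have [Zi|nZi] := pselect (participants Z i); last first.
  have Z0 : (prims Z :&: contracts_of N i)%SET = finset.set0.
    apply/finset.setP=> w; rewrite finset.in_setI !finset.in_set.
    apply/negP => /andP[/asboolP[z Zz <-] iz]; apply: nZi; exact: partZ Zz iz.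
  exists (dup N D s i); have /demandP[own ->] := dup_opt i.
  split=> //; first by rewrite Z0 finset.sub0set.
    by rewrite -dupE (fintype.subset_trans (finset.subsetIl _ _)) // finset.subsetUl.
  by rewrite /surcharge Z0 big_set0 subr0.
have [Y' cY'] := choice_ex Zi; have [sub ZY' dY' opt] := cY'.
have own : prims Y' \subset contracts_of N i.
  rewrite -(involving_id (Y := Y') (i := i)) ?prims_involving_own // => x.
  exact: chosen_involving.
have sZ : (prims Z :&: contracts_of N i)%SET \subset prims Y'.
  rewrite prims_involving; apply/fintype.subsetP=> w; rewrite !finset.in_set.
  by move=> /asboolP[z Zz <-]; apply/asboolP; exists z => //; apply: ZY'.
exists (prims Y'); split=> //.
  apply/fintype.subsetP=> w; rewrite finset.in_setU !finset.in_set.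
  move=> /asboolP[x Y'x <-]; case: (sub _ Y'x) => -[]; first by move=> /mem_out[-> _].
  by move=> Zx _; apply/orP; right; apply/asboolP; exists x.
have := opt (involving out i) (@subsetUl _ _ _).
rewrite utility_out_max (utility_chosen cY') lee_fin => /le_trans; apply.
rewrite /net_value -addrA lerD2l -opprD lerN2 /surcharge.
rewrite (big_setID (prims Z)) /= [leRHS](big_setID (prims Z)) /=.
have eqI : (prims Y' :&: prims Z)%SET = (prims Z :&: contracts_of N i)%SET.
  apply/eqP; rewrite finset.eqEsubset !finset.subsetI sZ finset.subsetIl !andbT /=.
  by rewrite finset.subsetIr /= (fintype.subset_trans (finset.subsetIl _ _)).
have -> : \sum_(w in (prims Y' :\: prims Z)%SET) blocking_price i w =
    \sum_(w in (prims Y' :\: prims Z)%SET) p i w.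
  by apply: eq_bigr => w; rewrite finset.in_setD => /andP[wZ _]; rewrite blocking_price_out.
rewrite eqI sumrB; lra.
Qed.

Lemma verif_output_unblocked : False.
Proof.
(* No set beats the maximum at [p], so no surcharge is positive; as they sum to zero, all vanish. *)
have sur_le i : surcharge i <= 0.
  have [Psi [own _ _ le]] := blocking_demand i.
  by have := indirect_utility_ub v (p i) own; lra.
have sur0 i : surcharge i = 0.
  apply/eqP; rewrite -oppr_eq0; apply/eqP.
  apply: (psumr_eq0P (P := xpredT) (F := fun i => - surcharge i)) => // [j _|].
    by rewrite oppr_ge0.
  by rewrite sumrN sum_surcharge oppr0.
(* Without surcharge [Psi] is itself demanded at [p], and its union with the output set is this
   trace. *)
have dT i : ((Phi :|: prims Z) :&: contracts_of N i)%SET \in D i.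
  have [Psi [own sZ sT]] := blocking_demand i; rewrite sur0 subr0 => le.
  have dPsi : Psi \in D i.
    by apply/demandP; split=> //; apply/le_anti; rewrite le indirect_utility_ub.
  have [dU _] := demand_lattice (gc (i := i)) (dup_opt i) dPsi.
  rewrite (_ : (_ :&: _)%SET = (dup N D s i :|: Psi)%SET) //.
  apply/eqP; rewrite finset.eqEsubset finset.setIUl dupE finset.setUS //=.
  rewrite finset.subUset finset.subsetUl /= -dupE -finset.setIUl.
  by rewrite finset.subsetI sT.
(* The common set [Phi :|: prims Z] is still available at step [s], which forces [tau z] into [Phi],
   against [Z_new]. *)
have [[z Zz] _ _] := Z_blocks; have [i iz] := N_gt0 (tau z).
have /negP := Z_new Zz; apply; apply/finset.bigcupP; exists i => //.
apply/mem_dup_in; exists ((Phi :|: prims Z) :&: contracts_of N i)%SET => //.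
rewrite (fintype.subset_trans (finset.subsetIl _ _)) /=; last first.
  exact: common_demand_sub_Omega_at.
rewrite finset.in_setI finset.in_setU !finset.in_set iz andbT; apply/orP; right.
by apply/asboolP; exists z.
Qed.

End Blocking.

Lemma verif_output_stable : stable v out.
Proof.
split; [exact: verif_output_distinct|exact: verif_output_rational|].
exact: verif_output_unblocked.
Qed.

End Stability.

(** * Termination of the auction and stability of its outcome *)

Lemma auction_path_invariant (R : realType) (I Omega : finType) (N : Omega -> {set I})
    (rep : price R I Omega -> reports I Omega) (p1 : price R I Omega) P n :
  balanced N p1 -> integral_price N p1 -> auction_path N rep p1 P n ->
  balanced N (P n) /\ integral_price N (P n).
Proof.
move=> p1_bal p1_int [n_gt0 P1 step].
have H r : (r < n)%N -> balanced N (P r.+1) /\ integral_price N (P r.+1).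
  elim: r => [|r IH] rn; first by rewrite P1.
  have [bal int] := IH (ltnW rn); have := step r.+1 rn => upd.
  by split; [apply: price_update_balanced upd bal | apply: price_update_int upd int].
by case: n n_gt0 step H => // n _ _ /(_ n (leqnn _)).
Qed.

Theorem theorem1 (R : realType) (I Omega : finType) (N : Omega -> {set I})
    (v : I -> {set Omega} -> R) (rep : price R I Omega -> reports I Omega)
    (p1 : price R I Omega)
    (N_ge2 : forall w, (2 <= #|N w|)%N)
    (v_int : forall i, integer_valued N v i)
    (v_gc : forall i, gross_complements N v i)
    (rep_truthful : truthful N v rep)
    (p1_bal : balanced N p1)
    (p1_int : integral_price N p1) :
  [/\ forall P n, auction_path N rep p1 P n ->
        (exists s, declares_eq N (rep (P n)) s) \/
        (exists s, declares_noneq N (rep (P n)) s /\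
           exists c, complements_chain N (rep (P n)) s c),
      ~ (exists P, forall n, (1 <= n)%N -> auction_path N rep p1 P n) &
      forall P n s, auction_path N rep p1 P n ->
        declares_eq N (rep (P n)) s ->
        stable v (verif_output (N := N) (rep (P n)) (P n) s)].
Proof.
have repE p : rep p = fun i => demand N v i (p i).
  by apply/funext=> i; apply: rep_truthful.
split=> [P n path|[P path]|P n s path].
- have [s reach [G0|GH]] := verification_stops N (rep (P n)).
    by left; exists s.
  right; exists s; split=> //; apply: chain_exists => //; rewrite repE.
  + by move=> i Psi /demandP[].
  + by move=> i; apply: demand_exists.
  + by move=> i Psi Psi'; apply: demand_lattice.
- pose L n := \sum_i indirect_utility N v i (P n i).
  (* The empty set costs nothing at any prices, which gives a lower bound independent of [n]. *)
  have L_lb n : \sum_i v i finset.set0 <= L n.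
    apply: ler_sum => i _.
    have := indirect_utility_ub v (P n i) (finset.sub0set (contracts_of N i)).
    by rewrite {1}/net_value big_set0 subr0.
  have L_ub n : L n.+1 + n%:R <= L 1%N.
    elim: n => [|n IH]; first by rewrite addr0.
    have [_ int] := auction_path_invariant p1_bal p1_int (path n.+1 isT).
    have [_ _ /(_ n.+1 (leqnn _))] := path n.+2 isT; rewrite repE => upd.
    have := price_update_descent v_gc v_int int upd; rewrite -/(L _) -/(L _).
    by move: IH; rewrite -[n.+1%:R]natr1; lra.
  pose d := L 1%N - \sum_i v i finset.set0.
  have d_ge0 : 0 <= d by rewrite subr_ge0 L_lb.
  (* [Num.bound d] exceeds [d], so that many updates would push [L] below its lower bound. *)
  have := archi_boundP d_ge0; have := L_ub (Num.bound d); have := L_lb (Num.bound d).+1.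
  by rewrite /d; lra.
have [bal _] := auction_path_invariant p1_bal p1_int path.
rewrite repE => eq_s; apply: verif_output_stable => // w.
by apply/card_gt0P; apply: leq_trans (N_ge2 w).
Qed.
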